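(* Let $\tau$ be the usual product topology on $\mathbb R\times\mathbb R$, and let $\mu$ be a $\mathcal C$-cross topology on $\mathbb R\times\mathbb R$ such that the family $\mathcal C$ contains a $\pi$-base for $\tau$. If $F\subseteq\mathbb R\times\mathbb R$ is meager with respect to $\tau$, then $F$ is meager with respect to $\mu$.
   Context: For $G\subseteq\mathbb R\times\mathbb R$, $G_x=\{y:(x,y)\in G\}$ and $G^y=\{x:(x,y)\in G\}$ denote the vertical and horizontal sections. $\mathcal C$-cross topology on $\mathbb R\times\mathbb R$: let $\mathcal C$ be a family of subsets of $\mathbb R\times\mathbb R$ which is closed under finite intersections and such that for each $G\in\mathcal C$ every non-empty vertical section $G_x$ and every non-empty horizontal section $G^y$ has non-empty interior in $\mathbb R$ (with its usual topology). The $\mathcal C$-cross topology is the topology on $\mathbb R\times\mathbb R$ generated by $\mathcal C$, for which $\mathcal C$ is a base. A $\pi$-base for a topology is a family of non-empty open sets such that every non-empty open set contains a member of the family. *)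

(* Defs.v *)
From HB Require Import structures.
From mathcomp Require Import all_boot all_order all_algebra.
From mathcomp Require Import all_classical all_reals all_analysis.

Set Implicit Arguments.
Unset Strict Implicit.
Unset Printing Implicit Defensive.

Import numFieldNormedType.Exports.

Local Open Scope classical_set_scope.

(* Alias of T carrying the topology generated by the subbase C, so that the
   same set T can be considered with several topologies. *)
Definition gen_topology (T : choiceType) (C : set (set T)) : Type := T.

Section GenTopology.
Variables (T : choiceType) (C : set (set T)).
HB.instance Definition _ := Choice.on (gen_topology C).
HB.instance Definition _ :=
  isSubBaseTopological.Build (gen_topology C) C id.
End GenTopology.

Definition nowhere_dense (T : topologicalType) (A : set T) : Prop :=
  (closure A)° = set0.

Definition meager (T : topologicalType) (A : set T) : Prop :=
  exists2 N : nat -> set T,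
    (forall n, nowhere_dense (N n)) & A = \bigcup_n N n.

Definition pi_base (T : topologicalType) (P : set (set T)) : Prop :=
  (forall U, P U -> open U /\ U !=set0) /\
  (forall V : set T, open V -> V !=set0 -> exists2 U, P U & U `<=` V).

(* xsection G x = {y | (x, y) \in G}, ysection G y = {x | (x, y) \in G}.
   The basis condition, for the topology generated by C, adds to the first
   condition only that C covers the plane. *)
Definition cross_family (R : realType) (C : set (set (R * R))) : Prop :=
  [/\ setI_closed C,
      @basis (gen_topology C) C
    & forall G, C G ->
        (forall x, xsection G x !=set0 -> (xsection G x)° !=set0) /\
        (forall y, ysection G y !=set0 -> (ysection G y)° !=set0)].

(* Main.v *)
Require Import Defs.
From mathcomp Require Import all_boot all_order all_algebra.
From mathcomp Require Import all_classical all_reals all_analysis.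

Import Order.TTheory Num.Theory.
Import numFieldNormedType.Exports.

Local Open Scope classical_set_scope.

(** A non-empty G in the family C is somewhere dense in the plane: some
    vertical section of G contains an open interval I, and for every y in I the
    horizontal section at y contains a rational interval. By the Baire category
    theorem one rational interval J serves for a set of y that is dense in some
    open set O, so G is dense in J x O. Given a nowhere dense set N, the set
    (closure G)° minus closure N is therefore non-empty and open, hence contains
    a member P of the pi-base; then G meets P, and the intersection of G and P is a
    non-empty member of C missing N. So N is nowhere dense for the cross
    topology. *)

(** Otherwise the complements of the closures are open and dense, and Baire yields a point of [V] in
    no [A i]. *)
Lemma baire_countable_cover {R : realType} {U : completeNormedModType R}
  {I : countType} (A : I -> set U) (V : set U) :
  V° !=set0 -> V `<=` \bigcup_i A i -> exists i, ~ nowhere_dense (A i).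
Proof.
move=> V0 VA; apply: contrapT => /forallNP nwdA.
(* Baire takes a sequence; an [n] that codes no index gets the whole space. *)
pose D (n : nat) : set U :=
  if unpickle n is Some i then ~` closure (A i) else setT.
have /Baire/(_ _ V0 (open_interior V)) [v [/interior_subset /VA [i _ Aiv] Dv]] :
    forall n, open (D n) /\ dense (D n).
  move=> n; rewrite /D; case: (unpickle n) => [i|]; last first.
    by split; [exact: openT | move=> O; rewrite setIT].
  split; first exact/closed_openC/closed_closure.
  move=> O [x Ox] oO; apply: contrapT => Odisj.
  have : (closure (A i))° x.
    apply: filterS (open_nbhs_nbhs (conj oO Ox)) => z Oz.
    by apply: contrapT => Az; apply: Odisj; exists z.
  by rewrite (contrapT (nwdA i)).
have := Dv (pickle i) Logic.I; rewrite /D pickleK; apply.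
exact: subset_closure.
Qed.

Lemma interior_rat_itv {R : realType} (A : set R) :
  A° !=set0 ->
  exists p q : rat, [/\ (p < q)%R & [set` `]ratr p, ratr q[%R] `<=` A].
Proof.
move=> [x /nbhs_ballP [e /= e0 xA]].
have xe : (x - e < x)%R by rewrite gtrBl.
have ex : (x < x + e)%R by rewrite ltrDl.
have [p] := rat_in_itvoo xe.
have [q] := rat_in_itvoo ex.
rewrite !in_itv /= => /andP[xq qe] /andP[ep px].
exists p, q; split; first by rewrite -(ltr_rat R) (lt_trans px).
apply: subset_trans xA; rewrite ball_itv; apply: subset_itvW; exact: ltW.
Qed.

Lemma somewhere_dense_sections {R : realType} {U : completeNormedModType R}
  (G : set (R * U)) (x : R) :
  (xsection G x)° !=set0 ->
  (forall y, ysection G y !=set0 -> (ysection G y)° !=set0) ->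
  ~ nowhere_dense G.
Proof.
move=> Gx Gy.
pose J (p : rat * rat) : set R := [set` `]ratr p.1, ratr p.2[%R].
(* For [p.1 >= p.2] the interval [J p] is empty and the inclusion vacuous, hence the first
   condition. *)
pose A p := [set y | (p.1 < p.2)%R /\ J p `<=` ysection G y].
have /(baire_countable_cover A _ Gx) [p] : xsection G x `<=` \bigcup_p A p.
  move=> y /xsectionP Gxy.
  have [|p [q [pq pqG]]] := interior_rat_itv (ysection G y).
    by apply: Gy; exists x; apply/ysectionP.
  by exists (p, q).
apply: contra_not => nwdG.
rewrite /nowhere_dense -subset0 => y /= Ay.
have [pq|pq] := boolP (p.1 < p.2)%R; last first.
  have A0 : A p = set0 by rewrite -subset0 => z [/(negP pq)].
  by move: Ay; rewrite A0 closure0 interior0.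
have ratr_pq : (ratr p.1 < ratr p.2 :> R)%R by rewrite ltr_rat.
have [a Ja] := rat_in_itvoo ratr_pq.
suff : (closure G)° (ratr a, y) by rewrite nwdG.
exists (J p, closure (A p)).
  by split => //=; apply: open_nbhs_nbhs; split => //; exact: itv_open.
(* Arbitrarily near [v] lies some [z] in [A p], and then [G] contains [(u, z)]. *)
move=> [u v] /= [Ju Av] W [[W1 W2] /= [uW1 vW2] W12].
have [z [[_ JG] W2z]] := Av _ vW2.
exists (u, z); split; first exact/ysectionP/JG.
by apply: W12; split => //=; exact: nbhs_singleton.
Qed.

Lemma nowhere_dense_cross {R : realType} (C : set (set (R * R)))
  (N : set (R * R)) :
  cross_family C -> (exists2 P, P `<=` C & pi_base P) ->
  nowhere_dense N -> @nowhere_dense (gen_topology C) N.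
Proof.
move=> [CI [Copen Cnbhs] Csec] [P PC [Popen Pbase]] nwdN.
rewrite /nowhere_dense -subset0 => -[x y] /Cnbhs [G [CG Gxy] GN].
(* so that closure G below refers to the product topology *)
change (set (R * R)) in G.
have [Gx Gy] := Csec _ CG.
have nwdG : ~ nowhere_dense G.
  apply: (somewhere_dense_sections G x) => //.
  by apply: Gx; exists y; apply/xsectionP.
pose W := (closure G)° `\` closure N.
have oW : open W.
  by apply: openI; [exact: open_interior | exact/closed_openC/closed_closure].
have W0 : W !=set0.
  (* If [W] is empty, the open set [(closure G)°] lies in [closure N], hence in its empty
     interior. *)
  apply: contrapT => W0; apply: nwdG; rewrite /nowhere_dense -subset0 -nwdN.
  rewrite -open_subsetE; last exact: open_interior.
  by move=> z Gz; apply: contrapT => Nz; apply: W0; exists z.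
have [V PV VW] := Pbase _ oW W0.
have [oV [v Vv]] := Popen _ PV.
have [vG _] := VW _ Vv.
have [z [Gz Vz]] := interior_subset vG _ (open_nbhs_nbhs (conj oV Vv)).
have oGV : @open (gen_topology C) (G `&` V) by apply/Copen/CI => //; exact: PC.
(* By [GN], [z] is in the closure of [N] for the cross topology. *)
have [t [Nt [_ /VW [_ nNt]]]] :=
  GN _ Gz _ (@open_nbhs_nbhs (gen_topology C) z _ (conj oGV (conj Gz Vz))).
exact/nNt/subset_closure.
Qed.

Theorem corollary6 (R : realType) (C : set (set (R * R))) (F : set (R * R))
  (crossC : cross_family C)
  (piC : exists2 P : set (set (R * R)), P `<=` C & pi_base P)
  (meagerF : meager F) :
  @meager (gen_topology C) F.
Proof.
have [N nwdN ->] := meagerF.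
by exists N => // n; exact: nowhere_dense_cross.
Qed.
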